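(* Let $a,b,c,d$ be generic real parameters, $k\ge 0$ an integer and $m$ a complex number. The function $$\Psi_{m,k}(x,y)=\psi_m^{(2k+b+c+1,\;d-b-c,\;2a+d+2)}(x)\,(1-x)^k\,\widehat P^{(b,c)}_k\!\Bigl(\tfrac{y}{1-x}\Bigr)$$ satisfies $$C_{23}\Psi_{m,k}=\frac{(2k+b+c+1)^2-1}{4}\,\Psi_{m,k},\qquad C_{123}\Psi_{m,k}=\frac{4m^2-1}{4}\,\Psi_{m,k}.$$
   Context: Functions are considered on the open triangle $\{(x,y): x>0,\ y>0,\ x+y<1\}$. ''Generic'' means that the hypergeometric series below are well defined, i.e. neither $b+1$ nor $2k+b+c+2$ is a non-positive integer. Special functions: ${}_2F_1$ is the Gauss hypergeometric function; $$\widehat P^{(\alpha,\beta)}_n(x)={}_2F_1(-n,\,n+\alpha+\beta+1;\,\alpha+1;\,x),$$ $$\psi_m^{(\beta,\gamma,\delta)}(x)=x^{m-\frac12(\delta+1)}\,{}_2F_1\bigl(m+\tfrac12(\beta+\gamma+1),\,m+\tfrac12(\beta-\gamma+1);\,\beta+1;\,1-x\bigr),\quad 0<x<1.$$ Operators: with $[A,B]=AB-BA$, $\{A,B\}=AB+BA$, $X_1$ = multiplication by $x$, $$L_1=y(1-x-y)\partial_y^2+\bigl((b+1)(1-x)-(b+c+2)y\bigr)\partial_y,$$ $$L=x(1-x)\partial_x^2+y(1-y)\partial_y^2-2xy\,\partial_x\partial_y+(a+1-(a+b+c+3)x)\partial_x+(b+1-(a+b+c+3)y)\partial_y,$$ $$C_{23}=-L_1+\tfrac{(b+c+1)^2-1}{4},\qquad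 C_{234}=-L+\tfrac{(a+b+c+2)^2-1}{4},$$ $$C_{123}=\tfrac{a+d+2}{2}[X_1,C_{234}]-\tfrac12\{X_1,C_{234}\}-\tfrac{(a+d+2)^2-(d-b-c)^2}{4}X_1+\tfrac{a^2+(a+d+2)^2-2}{4}.$$ *)

(* Defs.v *)
From Stdlib Require Import Reals Factorial.
From Coquelicot Require Import Coquelicot.
Local Open Scope C_scope.

Definition in_triangle (x y : R) : Prop := (0 < x /\ 0 < y /\ x + y < 1)%R.

Definition CSeries (u : nat -> C) : C :=
  (Series (fun n => Re (u n)), Series (fun n => Im (u n))).

(* [Derive] is real-valued, so functions of a real variable with complex
   values are differentiated componentwise. *)
Definition CDerive (f : R -> C) (t : R) : C :=
  (Derive (fun s => Re (f s)) t, Derive (fun s => Im (f s)) t).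

Definition Cexp (z : C) : C :=
  (exp (Re z) * cos (Im z), exp (Re z) * sin (Im z))%R.

(* Principal power; meaningful for [0 < x]. *)
Definition Rpow_C (x : R) (e : C) : C := Cexp (e * ln x).

Fixpoint Cpoch (z : C) (n : nat) : C :=
  match n with
  | O => 1
  | S n' => Cpoch z n' * (z + INR n')
  end.

(* Sum of the Gauss series; meaningful when [g] is not a non-positive integer
   and either [Cmod z < 1] or the series terminates. *)
Definition hyp2F1 (p q g z : C) : C :=
  CSeries (fun n => Cpoch p n * Cpoch q n / (Cpoch g n * INR (fact n)) * z ^ n).

Definition Phat (n : nat) (alpha beta x : R) : C :=
  hyp2F1 (- INR n) (INR n + alpha + beta + 1) (alpha + 1) x.

Definition psi (m : C) (beta gamma delta x : R) : C :=
  Rpow_C x (m - (delta + 1) / 2) *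
  hyp2F1 (m + (beta + gamma + 1) / 2) (m + (beta - gamma + 1) / 2)
         (beta + 1) (1 - x).

Definition Psi (a b c d : R) (m : C) (k : nat) (x y : R) : C :=
  psi m (2 * INR k + b + c + 1) (d - b - c) (2 * a + d + 2) x
  * (1 - x) ^ k * Phat k b c (y / (1 - x)).

Definition op : Type := (R -> R -> C) -> (R -> R -> C).

Definition dx : op := fun f x y => CDerive (fun t => f t y) x.
Definition dy : op := fun f x y => CDerive (fun t => f x t) y.
Definition X1 : op := fun f x y => x * f x y.

Definition comm (A B : op) : op := fun f x y => A (B f) x y - B (A f) x y.
Definition anticomm (A B : op) : op := fun f x y => A (B f) x y + B (A f) x y.

Definition L1 (b c : R) : op := fun f x y =>
  y * (1 - x - y) * dy (dy f) x y
  + ((b + 1) * (1 - x) - (b + c + 2) * y) * dy f x y.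

Definition L (a b c : R) : op := fun f x y =>
  x * (1 - x) * dx (dx f) x y + y * (1 - y) * dy (dy f) x y
  - 2 * x * y * dx (dy f) x y
  + (a + 1 - (a + b + c + 3) * x) * dx f x y
  + (b + 1 - (a + b + c + 3) * y) * dy f x y.

Definition C23 (b c : R) : op := fun f x y =>
  - L1 b c f x y + ((b + c + 1) ^ 2 - 1) / 4 * f x y.

Definition C234 (a b c : R) : op := fun f x y =>
  - L a b c f x y + ((a + b + c + 2) ^ 2 - 1) / 4 * f x y.

Definition C123 (a b c d : R) : op := fun f x y =>
  (a + d + 2) / 2 * comm X1 (C234 a b c) f x y
  - 1 / 2 * anticomm X1 (C234 a b c) f x y
  - ((a + d + 2) ^ 2 - (d - b - c) ^ 2) / 4 * X1 f x y
  + (a ^ 2 + (a + d + 2) ^ 2 - 2) / 4 * f x y.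

(* [Derive] is total, so existence of the partial derivatives occurring in the
   operators above has to be said separately. *)
Definition partials_exist (f : R -> R -> C) (x y : R) : Prop :=
  let dble (g : R -> C) (t : R) := ex_derive (V := C_R_NormedModule) g t in
  dble (fun t => f t y) x /\ dble (fun t => f x t) y /\
  dble (fun t => dx f t y) x /\ dble (fun t => dy f x t) y /\
  dble (fun t => dy f t y) x.

(* Main.v *)
(* The function separates as A(x) P(u) with u = y/(1-x), where
   A(x) = x^e (1-x)^k F(1-x), and F and P satisfy Gauss equations.
   The second derivatives A'' and P'' are therefore combinations of lower ones;
   substituting them in the operators reduces both eigenvalue equations to
   identities between rational functions.  The Gauss equation comes from
   differentiating the hypergeometric series termwise: the real and imaginary
   parts are real power series, which converge on the unit disk by the ratio
   of consecutive coefficients. *)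

Require Import Defs.
From Stdlib Require Import Reals.
From Coquelicot Require Import Coquelicot.
From Stdlib Require Import Lra Lia Factorial.

(** * Differentiation of complex-valued functions of a real variable *)

Section Separation.
Local Open Scope C_scope.

(** A relation, unlike the total [CDerive], carries the existence of the derivative along with its
    value. *)
Definition is_CDerive (f : R -> C) (t : R) (l : C) : Prop :=
  is_derive (fun s => Re (f s)) t (Re l) /\
  is_derive (fun s => Im (f s)) t (Im l).

Lemma is_CDerive_unique f t l : is_CDerive f t l -> CDerive f t = l.
Proof.
  intros [Hr Hi].
  apply injective_projections; [exact (is_derive_unique _ _ _ Hr)
    | exact (is_derive_unique _ _ _ Hi)].
Qed.

(** As a vector-valued map, [f] is the sum of [Re f] times [1] and [Im f] times [Ci]: real functions
    scaling constant vectors. *)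
Lemma is_CDerive_ex f t l :
  is_CDerive f t l -> ex_derive (V := C_R_NormedModule) f t.
Proof.
  intros [Hr Hi]. eexists.
  apply is_derive_ext with
    (f := fun s => plus (scal (Re (f s)) (RtoC 1 : C_R_NormedModule))
                        (scal (Im (f s)) (Ci : C_R_NormedModule))).
  - intros s. rewrite !scal_R_Cmult. destruct (f s) as [u v].
    apply injective_projections; cbn; ring.
  - apply @is_derive_plus; apply @is_derive_scal_l; eassumption.
Qed.

Lemma is_CDerive_ext_loc f g t l :
  locally t (fun s => f s = g s) -> is_CDerive f t l -> is_CDerive g t l.
Proof.
  intros E [Hr Hi]; split.
  - apply is_derive_ext_loc with (2 := Hr).
    apply filter_imp with (2 := E). now intros s ->.
  - apply is_derive_ext_loc with (2 := Hi).
    apply filter_imp with (2 := E). now intros s ->.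
Qed.

Lemma is_CDerive_ext f g t l :
  (forall s, f s = g s) -> is_CDerive f t l -> is_CDerive g t l.
Proof. intros E. apply is_CDerive_ext_loc, filter_forall, E. Qed.

Lemma is_CDerive_RtoC (f : R -> R) t l :
  is_derive f t l -> is_CDerive (fun s => RtoC (f s)) t (RtoC l).
Proof.
  intros H; split; cbn; [exact H | apply @is_derive_const].
Qed.

Lemma is_CDerive_const z t : is_CDerive (fun _ => z) t 0.
Proof. split; cbn; apply @is_derive_const. Qed.

Lemma is_CDerive_plus f g t lf lg :
  is_CDerive f t lf -> is_CDerive g t lg ->
  is_CDerive (fun s => f s + g s) t (lf + lg).
Proof. intros [] []; split; cbn; now apply @is_derive_plus. Qed.

Lemma is_CDerive_mult f g t lf lg :
  is_CDerive f t lf -> is_CDerive g t lg ->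
  is_CDerive (fun s => f s * g s) t (lf * g t + f t * lg).
Proof.
  intros [fr fi] [gr gi].
  assert (M : forall (u v : R -> R) du dv, is_derive u t du ->
    is_derive v t dv ->
    is_derive (fun s => (u s * v s)%R) t (du * v t + u t * dv)%R).
  { intros u v du dv Hu Hv.
    apply (is_derive_mult u v t du dv Hu Hv). intros; apply Rmult_comm. }
  pose proof (M _ _ _ _ fr gr) as Hrr. pose proof (M _ _ _ _ fi gi) as Hii.
  pose proof (M _ _ _ _ fr gi) as Hri. pose proof (M _ _ _ _ fi gr) as Hir.
  split.
  - replace (Re (lf * g t + f t * lg))
      with (minus (Re lf * Re (g t) + Re (f t) * Re lg)
                  (Im lf * Im (g t) + Im (f t) * Im lg))%R
      by (unfold minus, plus, opp, Re, Im; cbn; ring).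
    exact (is_derive_minus _ _ _ _ _ Hrr Hii).
  - replace (Im (lf * g t + f t * lg))
      with (plus (Re lf * Im (g t) + Re (f t) * Im lg)
                 (Im lf * Re (g t) + Im (f t) * Re lg))%R
      by (unfold plus, Re, Im; cbn; ring).
    exact (is_derive_plus _ _ _ _ _ Hri Hir).
Qed.

Lemma is_CDerive_comp f (r : R -> R) t l dr :
  is_CDerive f (r t) l -> is_derive r t dr ->
  is_CDerive (fun s => f (r s)) t (dr * l).
Proof.
  intros [fr fi] Hr. split.
  - rewrite re_scal_l. exact (is_derive_comp _ _ _ _ _ fr Hr).
  - rewrite im_scal_l. exact (is_derive_comp _ _ _ _ _ fi Hr).
Qed.

(** Separates the mechanical production of a derivative from the algebra that brings it to the
    wanted form. *)
Lemma is_CDerive_eq f t l l' : is_CDerive f t l -> l = l' -> is_CDerive f t l'.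
Proof. now intros H <-. Qed.

(** For real [x] the power is exp(Re e ln x) times the cosine and sine of Im e ln x, and each
    component is an elementary real function. *)
Lemma is_CDerive_Rpow_C e x :
  (0 < x)%R -> is_CDerive (fun s => Rpow_C s e) x (e / x * Rpow_C x e).
Proof.
  intros Hx.
  assert (Hx' : x <> 0%R) by lra.
  replace (e / x) with (e * RtoC (/ x)) by (rewrite RtoC_inv by easy; reflexivity).
  unfold Rpow_C, Cexp.
  split.
  - apply is_derive_ext with
      (f := fun s => (exp (Re e * ln s) * cos (Im e * ln s))%R).
    { intros s. now rewrite re_scal_r, im_scal_r. }
    auto_derive; [easy|]. rewrite re_scal_r, im_scal_r.
    unfold Re, Im; cbn. unfold Re, Im. field. easy.
  - apply is_derive_ext with
      (f := fun s => (exp (Re e * ln s) * sin (Im e * ln s))%R).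
    { intros s. now rewrite re_scal_r, im_scal_r. }
    auto_derive; [easy|]. rewrite re_scal_r, im_scal_r.
    unfold Re, Im; cbn. unfold Re, Im. field. easy.
Qed.

(** * Complex power series in a real variable *)

Definition is_CPSeries (u : nat -> C) (t : R) (s : C) : Prop :=
  is_pseries (fun n => Re (u n)) t (Re s) /\
  is_pseries (fun n => Im (u n)) t (Im s).

Lemma is_CPSeries_ext u v t s :
  (forall n, u n = v n) -> is_CPSeries u t s -> is_CPSeries v t s.
Proof.
  intros E [Hr Hi]; split; eapply is_pseries_ext; try eassumption;
    intros n; cbn; now rewrite E.
Qed.

Lemma is_CPSeries_unique u t s s' :
  is_CPSeries u t s -> is_CPSeries u t s' -> s = s'.
Proof.
  intros [r1 i1] [r2 i2].
  apply is_pseries_unique in r1, i1, r2, i2.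
  apply injective_projections; unfold Re, Im in *; congruence.
Qed.

Lemma is_CPSeries_plus u v t s s' :
  is_CPSeries u t s -> is_CPSeries v t s' ->
  is_CPSeries (fun n => u n + v n) t (s + s').
Proof.
  intros [r1 i1] [r2 i2]; split; cbn.
  - exact (is_pseries_plus _ _ _ _ _ r1 r2).
  - exact (is_pseries_plus _ _ _ _ _ i1 i2).
Qed.

Lemma is_CPSeries_scal z u t s :
  is_CPSeries u t s -> is_CPSeries (fun n => z * u n) t (z * s).
Proof.
  intros [Hr Hi].
  assert (M : forall c a l, is_pseries a t l ->
    is_pseries (fun n => (c * a n)%R) t (c * l)%R).
  { intros c a l H. apply (is_pseries_scal c a t l); [apply Rmult_comm | exact H]. }
  split.
  - exact (is_pseries_minus _ _ _ _ _ (M (Re z) _ _ Hr) (M (Im z) _ _ Hi)).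
  - exact (is_pseries_plus _ _ _ _ _ (M (Re z) _ _ Hi) (M (Im z) _ _ Hr)).
Qed.

(** Multiplication of a series by its variable, expressed on coefficients; it aligns terms such as t
    F' with the powers of F. *)
Definition shift (u : nat -> C) (n : nat) : C :=
  match n with O => 0 | S n' => u n' end.

Lemma is_CPSeries_shift u t s :
  is_CPSeries u t s -> is_CPSeries (shift u) t (t * s).
Proof.
  intros [Hr Hi]; split.
  - rewrite re_scal_l. apply is_pseries_ext with (2 := is_pseries_incr_1 _ _ _ Hr).
    now intros [|n].
  - rewrite im_scal_l. apply is_pseries_ext with (2 := is_pseries_incr_1 _ _ _ Hi).
    now intros [|n].
Qed.

(** Both radii are at least 1, phrased pointwise in the strict form that convergence and termwise
    differentiation ask for. *)
Definition unit_disk_conv (u : nat -> C) : Prop :=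
  forall t, (Rabs t < 1)%R ->
    Rbar_lt (Rabs t) (CV_radius (fun n => Re (u n))) /\
    Rbar_lt (Rabs t) (CV_radius (fun n => Im (u n))).

Definition CPSeries (u : nat -> C) (t : R) : C := CSeries (fun n => u n * t ^ n).

Lemma CPSeries_components u t :
  CPSeries u t = (PSeries (fun n => Re (u n)) t, PSeries (fun n => Im (u n)) t).
Proof.
  unfold CPSeries, CSeries, PSeries.
  f_equal; apply Series_ext; intros n; rewrite <- RtoC_pow.
  - apply re_scal_r.
  - apply im_scal_r.
Qed.

Lemma CPSeries_correct u t :
  unit_disk_conv u -> (Rabs t < 1)%R -> is_CPSeries u t (CPSeries u t).
Proof.
  intros Hu Ht. rewrite CPSeries_components. destruct (Hu t Ht).
  split; cbn; apply PSeries_correct, CV_radius_inside; assumption.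
Qed.

Definition CPS_derive (u : nat -> C) (n : nat) : C := INR (S n) * u (S n).

Lemma unit_disk_conv_derive u :
  unit_disk_conv u -> unit_disk_conv (CPS_derive u).
Proof.
  intros Hu t Ht. destruct (Hu t Ht) as [Hr Hi].
  rewrite <- CV_radius_derive in Hr, Hi.
  split.
  - rewrite (CV_radius_ext _ (PS_derive (fun n => Re (u n)))); [exact Hr|].
    intros n. apply re_scal_l.
  - rewrite (CV_radius_ext _ (PS_derive (fun n => Im (u n)))); [exact Hi|].
    intros n. apply im_scal_l.
Qed.

Lemma is_CDerive_CPSeries u t :
  unit_disk_conv u -> (Rabs t < 1)%R ->
  is_CDerive (CPSeries u) t (CPSeries (CPS_derive u) t).
Proof.
  intros Hu Ht. destruct (Hu t Ht) as [Hr Hi].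
  apply is_CDerive_ext with (f := fun s =>
    (PSeries (fun n => Re (u n)) s, PSeries (fun n => Im (u n)) s)).
  { intros s. symmetry. apply CPSeries_components. }
  rewrite CPSeries_components. split; cbn [Re Im fst snd].
  - rewrite (PSeries_ext _ (PS_derive (fun n => Re (u n))))
      by (intros n; apply re_scal_l).
    now apply is_derive_PSeries.
  - rewrite (PSeries_ext _ (PS_derive (fun n => Im (u n))))
      by (intros n; apply im_scal_l).
    now apply is_derive_PSeries.
Qed.

(** * The Gauss hypergeometric equation *)

(** The finitely many values up to [N] have a maximum, and every later value is at most [v N]. *)
Lemma eventually_decreasing_bounded (v : nat -> R) N :
  (forall n, (N <= n)%nat -> (v (S n) <= v n)%R) ->
  exists M, forall n, (v n <= M)%R.
Proof.
  intros Hv.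
  assert (B : forall K, exists M, forall n, (n <= K)%nat -> (v n <= M)%R).
  { induction K as [|K [M HM]].
    - exists (v O). intros n Hn. replace n with O by lia. lra.
    - exists (Rmax M (v (S K))). intros n Hn.
      destruct (Nat.eq_dec n (S K)) as [->|Hne]; [apply Rmax_r|].
      apply Rle_trans with M; [apply HM; lia | apply Rmax_l]. }
  destruct (B N) as [M HM]. exists M. intros n.
  destruct (Nat.le_gt_cases n N) as [Hn|Hn]; [now apply HM|].
  apply Rle_trans with (v N); [|now apply HM].
  replace n with (N + (n - N))%nat by lia.
  induction (n - N)%nat as [|j IH]; [rewrite Nat.add_0_r; lra|].
  rewrite Nat.add_succ_r. apply Rle_trans with (2 := IH). apply Hv. lia.
Qed.

Lemma CV_radius_gt_of_bounded (a : nat -> R) r t :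
  (Rabs t < r)%R -> (exists M, forall n, (Rabs (a n) * r ^ n <= M)%R) ->
  Rbar_lt (Rabs t) (CV_radius a).
Proof.
  intros Ht [M HM]. apply Rbar_lt_le_trans with (y := Finite r); [exact Ht|].
  apply (proj1 (CV_radius_bounded a)). exists M. intros n.
  pose proof (Rabs_pos t).
  rewrite Rabs_mult, (Rabs_pos_eq (r ^ n)); [apply HM | apply pow_le; lra].
Qed.

Section Gauss.
Variables p q g : C.
Hypothesis Hg : forall n, g + INR n <> 0.

Definition gauss_coef (n : nat) : C :=
  Cpoch p n * Cpoch q n / (Cpoch g n * INR (fact n)).

Lemma Cpoch_neq_0 n : Cpoch g n <> 0.
Proof.
  induction n as [|n IH]; cbn; [apply C1_nz | now apply Cmult_neq_0].
Qed.

(** The ratio of consecutive coefficients with denominators cleared. It serves twice: for the growth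
    bound and as the coefficientwise form of the Gauss equation. *)
Lemma gauss_coef_rec n :
  INR (S n) * (g + INR n) * gauss_coef (S n)
  = (p + INR n) * (q + INR n) * gauss_coef n.
Proof.
  assert (Hn : forall j, j <> O -> RtoC (INR j) <> 0).
  { intros j Hj E. apply RtoC_inj in E. now apply (not_0_INR j Hj). }
  unfold gauss_coef. cbn [Cpoch]. rewrite fact_simpl, mult_INR, RtoC_mult.
  field. pose proof (Cpoch_neq_0 n).
  pose proof (fact_neq_0 n). repeat split; auto.
Qed.

(** The ratio of consecutive coefficients tends to 1 in modulus, so the factor r < 1 makes the
    weighted terms decrease from some index on. *)
Lemma gauss_coef_bounded r :
  (0 < r < 1)%R -> exists M, forall n, (Cmod (gauss_coef n) * r ^ n <= M)%R.
Proof.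
  intros Hr.
  set (A := Cmod p). set (B := Cmod q). set (G := Cmod g).
  pose proof (Cmod_ge_0 p : (0 <= A)%R). pose proof (Cmod_ge_0 q : (0 <= B)%R).
  pose proof (Cmod_ge_0 g : (0 <= G)%R).
  (* Beyond this threshold x - G is positive, and (1 - r) x^2 dominates the lower-order terms of r
     (x + A)(x + B) - (x + 1)(x - G). Of the 2 G, one absorbs G x and the other the constant G. *)
  destruct (INR_archimed 1 ((2 * G + A + B + A * B) / (1 - r) + G + 1))
    as [N HN]; [lra|].
  assert (Hq : (0 <= (2 * G + A + B + A * B) / (1 - r))%R)
    by (apply Rdiv_le_0_compat; nra).
  apply eventually_decreasing_bounded with N. intros n Hn.
  apply le_INR in Hn. set (x := INR n) in *.
  assert (Hx1 : (G + 1 < x)%R) by lra.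
  assert (Hx2 : (2 * G + A + B + A * B <= (1 - r) * x)%R).
  { apply Rmult_le_reg_r with (/ (1 - r))%R; [apply Rinv_0_lt_compat; lra|].
    replace ((1 - r) * x * / (1 - r))%R with x by (field; lra).
    unfold Rdiv in *. lra. }
  assert (Hpoly : (r * ((x + A) * (x + B)) <= (x + 1) * (x - G))%R).
  { assert (x * (2 * G + A + B + A * B) <= x * ((1 - r) * x))%R
      by (apply Rmult_le_compat_l; lra).
    assert (0 <= (1 - r) * (x * (A + B)))%R
      by (repeat apply Rmult_le_pos; lra).
    assert (A * B <= x * (A * B))%R by (assert (0 <= A * B)%R by nra; nra).
    assert (r * (A * B) <= A * B)%R by (assert (0 <= A * B)%R by nra; nra).
    assert (G <= x * G)%R by nra. nra. }
  pose proof (f_equal Cmod (gauss_coef_rec n)) as E.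
  rewrite !Cmod_mult, Cmod_R, (Rabs_pos_eq _ (pos_INR _)), S_INR in E.
  fold x in E.
  assert (Tri : forall z, (Cmod (z + x) <= x + Cmod z)%R).
  { intros z. pose proof (Cmod_triangle z x) as T.
    rewrite Cmod_R, Rabs_pos_eq in T; lra. }
  pose proof (Tri p) as Tp. pose proof (Tri q) as Tq.
  assert (Tg : (x - G <= Cmod (g + x))%R).
  { pose proof (Cmod_triangle (g + x) (- g)) as T.
    replace (g + x + - g) with (RtoC x) in T by ring.
    rewrite Cmod_opp, Cmod_R, Rabs_pos_eq in T by lra. fold G in T. lra. }
  fold A in Tp. fold B in Tq.
  pose proof (Cmod_ge_0 (p + x)). pose proof (Cmod_ge_0 (q + x)).
  set (v := Cmod (gauss_coef n)) in *. set (w := Cmod (gauss_coef (S n))) in *.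
  assert (Hv : (0 <= v)%R) by apply Cmod_ge_0.
  assert (Hw : (0 <= w)%R) by apply Cmod_ge_0.
  assert (Hwv : (w * r <= v)%R).
  { apply Rmult_le_reg_l with ((x + 1) * (x - G))%R; [nra|].
    apply Rle_trans with (r * ((x + 1) * Cmod (g + x) * w))%R.
    - replace ((x + 1) * (x - G) * (w * r))%R
        with ((x - G) * ((x + 1) * (w * r)))%R by ring.
      replace (r * ((x + 1) * Cmod (g + x) * w))%R
        with (Cmod (g + x) * ((x + 1) * (w * r)))%R by ring.
      apply Rmult_le_compat_r; [|easy].
      repeat apply Rmult_le_pos; lra.
    - rewrite E. rewrite <- Rmult_assoc. apply Rmult_le_compat_r; [easy|].
      apply Rle_trans with (2 := Hpoly). apply Rmult_le_compat_l; [lra|].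
      apply Rmult_le_compat; lra. }
  cbn [pow]. rewrite <- Rmult_assoc. apply Rmult_le_compat_r; [|easy].
  apply pow_le; lra.
Qed.

Lemma gauss_unit_disk_conv : unit_disk_conv gauss_coef.
Proof.
  intros t Ht. pose proof (Rabs_pos t).
  (* The midpoint of |t| and 1 lies strictly between them, and each component is bounded by the
     modulus. *)
  destruct (gauss_coef_bounded ((1 + Rabs t) / 2)) as [M HM]; [lra|].
  assert (P : forall n, (0 <= ((1 + Rabs t) / 2) ^ n)%R)
    by (intros; apply pow_le; lra).
  split; apply CV_radius_gt_of_bounded with ((1 + Rabs t) / 2)%R;
    try lra; exists M; intros n; apply Rle_trans with (2 := HM n);
    apply Rmult_le_compat_r; auto.
  - apply re_le_Cmod.
  - apply Rle_trans with (2 := Rmax_Cmod _). apply Rmax_r.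
Qed.

(** Comparing coefficients of t^n turns the equation into [gauss_coef_rec]. The derivatives are
    chosen before [t], so that [F1] is a function that can itself be differentiated. *)
Lemma hyp2F1_ode :
  exists F1 F2 : R -> C, forall t, (Rabs t < 1)%R ->
    is_CDerive (fun s => hyp2F1 p q g s) t (F1 t) /\
    is_CDerive F1 t (F2 t) /\
    t * (1 - t) * F2 t + (g - (p + q + 1) * t) * F1 t = p * q * hyp2F1 p q g t.
Proof.
  set (u := gauss_coef).
  set (u1 := CPS_derive u). set (u2 := CPS_derive u1).
  pose proof gauss_unit_disk_conv as Hu0. fold u in Hu0.
  pose proof (unit_disk_conv_derive u Hu0) as Hu1. fold u1 in Hu1.
  pose proof (unit_disk_conv_derive u1 Hu1) as Hu2. fold u2 in Hu2.
  exists (CPSeries u1), (CPSeries u2). intros t Ht.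
  split; [exact (is_CDerive_CPSeries u t Hu0 Ht)|].
  split; [exact (is_CDerive_CPSeries u1 t Hu1 Ht)|].
  change (hyp2F1 p q g t) with (CPSeries u t).
  pose proof (CPSeries_correct u t Hu0 Ht) as S0.
  pose proof (CPSeries_correct u1 t Hu1 Ht) as S1.
  pose proof (CPSeries_correct u2 t Hu2 Ht) as S2.
  pose proof (is_CPSeries_shift _ _ _ S1) as S1'.
  pose proof (is_CPSeries_shift _ _ _ S2) as S2'.
  pose proof (is_CPSeries_shift _ _ _ S2') as S2''.
  apply Ceq_minus.
  (* Zero is presented as the sum of the series with coefficients [0 * u n]; uniqueness of sums then
     reduces the equation to its coefficients. *)
  replace (RtoC 0) with (0 * CPSeries u t) by ring.
  apply is_CPSeries_unique with (2 := is_CPSeries_scal 0 _ _ _ S0).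
  pose proof (is_CPSeries_plus _ _ _ _ _ S2'
    (is_CPSeries_plus _ _ _ _ _ (is_CPSeries_scal (- (1)) _ _ _ S2'')
    (is_CPSeries_plus _ _ _ _ _ (is_CPSeries_scal g _ _ _ S1)
    (is_CPSeries_plus _ _ _ _ _ (is_CPSeries_scal (- (p + q + 1)) _ _ _ S1')
      (is_CPSeries_scal (- (p * q)) _ _ _ S0))))) as H.
  match type of H with is_CPSeries _ _ ?v =>
    match goal with |- is_CPSeries _ _ ?w => replace w with v by ring end end.
  apply is_CPSeries_ext with (2 := H). intros n.
  pose proof (gauss_coef_rec n) as E. fold u in E.
  (* Since p q = (p + n)(q + n) - (p + q + n) n, this exposes the right side of the recurrence. *)
  replace (- (p * q) * u n) with
    ((p + q + INR n) * INR n * u n - (p + INR n) * (q + INR n) * u n) by ring.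
  rewrite <- E.
  (* The indices 0 and 1 are separate because the double shift in t^2 F'' puts default zeros
     there. *)
  destruct n as [|[|n]]; unfold shift, u2, u1, CPS_derive;
    rewrite ?S_INR, ?RtoC_plus; cbn [INR]; ring.
Qed.

End Gauss.

(** * Jets of functions of two variables *)

(** Explicit partials on the whole open triangle, since a second derivative at a point depends on
    the first derivative nearby. The mixed entry differentiates in y first, as [L] does. *)
Definition has_jet (f fx fy fxx fxy fyy : R -> R -> C) : Prop :=
  forall x y, in_triangle x y ->
    is_CDerive (fun t => f t y) x (fx x y) /\
    is_CDerive (fun t => f x t) y (fy x y) /\
    is_CDerive (fun t => fx t y) x (fxx x y) /\
    is_CDerive (fun t => fy t y) x (fxy x y) /\
    is_CDerive (fun t => fy x t) y (fyy x y).

Lemma in_triangle_locally_x x y :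
  in_triangle x y -> locally x (fun t => in_triangle t y).
Proof.
  intros (Hx & Hy & Hxy).
  assert (He : (0 < Rmin x (1 - x - y))%R) by (apply Rmin_pos; lra).
  exists (mkposreal _ He). intros t Ht.
  apply Rabs_lt_between in Ht. cbn in Ht.
  unfold minus, plus, opp in Ht; cbn in Ht.
  pose proof (Rmin_l x (1 - x - y)). pose proof (Rmin_r x (1 - x - y)).
  repeat split; lra.
Qed.

Lemma in_triangle_locally_y x y :
  in_triangle x y -> locally y (fun t => in_triangle x t).
Proof.
  intros H.
  assert (H' : in_triangle y x) by (unfold in_triangle in *; lra).
  apply filter_imp with (2 := in_triangle_locally_x y x H').
  unfold in_triangle; intros t; lra.
Qed.

Section Jet.
Variables f fx fy fxx fxy fyy : R -> R -> C.
Hypothesis J : has_jet f fx fy fxx fxy fyy.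

Lemma jet_dx x y : in_triangle x y -> dx f x y = fx x y.
Proof. intros H. apply is_CDerive_unique, J, H. Qed.

Lemma jet_dy x y : in_triangle x y -> dy f x y = fy x y.
Proof. intros H. apply is_CDerive_unique. now destruct (J x y H) as (_ & ? & _). Qed.

(** The triangle is open, so [dx f] agrees with [fx] on a neighbourhood and the two have the same
    derivative. *)
Lemma jet_is_CDerive_dx_dx x y :
  in_triangle x y -> is_CDerive (fun t => dx f t y) x (fxx x y).
Proof.
  intros H. apply is_CDerive_ext_loc with (f := fun t => fx t y).
  - apply filter_imp with (2 := in_triangle_locally_x x y H).
    intros t Ht. symmetry. now apply jet_dx.
  - now destruct (J x y H) as (_ & _ & ? & _).
Qed.

Lemma jet_is_CDerive_dx_dy x y :
  in_triangle x y -> is_CDerive (fun t => dy f t y) x (fxy x y).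
Proof.
  intros H. apply is_CDerive_ext_loc with (f := fun t => fy t y).
  - apply filter_imp with (2 := in_triangle_locally_x x y H).
    intros t Ht. symmetry. now apply jet_dy.
  - now destruct (J x y H) as (_ & _ & _ & ? & _).
Qed.

Lemma jet_is_CDerive_dy_dy x y :
  in_triangle x y -> is_CDerive (fun t => dy f x t) y (fyy x y).
Proof.
  intros H. apply is_CDerive_ext_loc with (f := fun t => fy x t).
  - apply filter_imp with (2 := in_triangle_locally_y x y H).
    intros t Ht. symmetry. now apply jet_dy.
  - now destruct (J x y H) as (_ & _ & _ & _ & ?).
Qed.

Lemma jet_partials_exist x y : in_triangle x y -> partials_exist f x y.
Proof.
  intros H. destruct (J x y H) as (H1 & H2 & _).
  repeat split; eapply is_CDerive_ex.
  - exact H1.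
  - exact H2.
  - now apply jet_is_CDerive_dx_dx.
  - now apply jet_is_CDerive_dy_dy.
  - now apply jet_is_CDerive_dx_dy.
Qed.

Lemma jet_L1 b c x y : in_triangle x y ->
  L1 b c f x y = y * (1 - x - y) * fyy x y
    + ((b + 1) * (1 - x) - (b + c + 2) * y) * fy x y.
Proof.
  intros H. unfold L1. rewrite (jet_dy x y H).
  unfold dy at 1. now rewrite (is_CDerive_unique _ _ _ (jet_is_CDerive_dy_dy x y H)).
Qed.

Lemma jet_L a b c x y : in_triangle x y ->
  L a b c f x y =
    x * (1 - x) * fxx x y + y * (1 - y) * fyy x y - 2 * x * y * fxy x y
    + (a + 1 - (a + b + c + 3) * x) * fx x y
    + (b + 1 - (a + b + c + 3) * y) * fy x y.
Proof.
  intros H. unfold L.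
  pose proof (is_CDerive_unique _ _ _ (jet_is_CDerive_dy_dy x y H)) as Hyy.
  pose proof (is_CDerive_unique _ _ _ (jet_is_CDerive_dx_dy x y H)) as Hxy.
  pose proof (is_CDerive_unique _ _ _ (jet_is_CDerive_dx_dx x y H)) as Hxx.
  change (dx (dx f) x y = fxx x y) in Hxx.
  change (dx (dy f) x y = fxy x y) in Hxy.
  change (dy (dy f) x y = fyy x y) in Hyy.
  now rewrite Hxx, Hxy, Hyy, (jet_dx x y H), (jet_dy x y H).
Qed.

End Jet.

(** Recursion on sums and products; the leaves are constants or functions whose derivative is a
    hypothesis in context. *)
Ltac cderive := lazymatch goal with
  | |- is_CDerive (fun _ => ?z) _ _ => apply is_CDerive_const
  | |- is_CDerive (fun s => Cplus _ _) _ _ => apply is_CDerive_plus; cderive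
  | |- is_CDerive (fun s => Cmult _ _) _ _ => apply is_CDerive_mult; cderive
  | |- _ => eassumption
  end.

Lemma is_CDerive_id (t : R) : is_CDerive (fun s => RtoC s) t 1.
Proof. apply is_CDerive_RtoC, @is_derive_id. Qed.

(** The commutator and anticommutator in [C123] apply [C234] to x f, whose partials come from the
    product rule. *)
Lemma jet_X1 f fx fy fxx fxy fyy :
  has_jet f fx fy fxx fxy fyy ->
  has_jet (X1 f) (fun x y => f x y + x * fx x y) (fun x y => x * fy x y)
    (fun x y => 2 * fx x y + x * fxx x y)
    (fun x y => fy x y + x * fxy x y) (fun x y => x * fyy x y).
Proof.
  intros J x y H. destruct (J x y H) as (H1 & H2 & H3 & H4 & H5).
  pose proof (is_CDerive_id x) as Hx.
  unfold X1. refine (conj _ (conj _ (conj _ (conj _ _)))).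
  all: eapply is_CDerive_eq; [cderive |].
  all: cbn beta; ring.
Qed.

(** * Functions separated in x and u = y/(1-x) *)

Lemma triangle_ratio x y : in_triangle x y -> (0 < y / (1 - x) < 1)%R.
Proof.
  intros (Hx & Hy & Hxy). split; [apply Rdiv_lt_0_compat; lra |].
  apply Rmult_lt_reg_r with (1 - x)%R; [lra |].
  unfold Rdiv. rewrite Rmult_assoc, Rinv_l; lra.
Qed.

(** Product and chain rules with u_x = y/(1-x)^2, u_y = 1/(1-x), u_xx = 2y/(1-x)^3, u_xy = 1/(1-x)^2
    and u_yy = 0. *)
Lemma separated_jet (A A1 A2 P P1 P2 : R -> C) :
  (forall x, (0 < x < 1)%R -> is_CDerive A x (A1 x) /\ is_CDerive A1 x (A2 x)) ->
  (forall u, (0 < u < 1)%R -> is_CDerive P u (P1 u) /\ is_CDerive P1 u (P2 u)) ->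
  has_jet (fun x y => A x * P (y / (1 - x))%R)
    (fun x y => A1 x * P (y / (1 - x))%R
       + A x * (RtoC (y / (1 - x) ^ 2) * P1 (y / (1 - x))%R))
    (fun x y => A x * (RtoC (/ (1 - x)) * P1 (y / (1 - x))%R))
    (fun x y => A2 x * P (y / (1 - x))%R
       + 2 * A1 x * (RtoC (y / (1 - x) ^ 2) * P1 (y / (1 - x))%R)
       + A x * (RtoC (2 * y / (1 - x) ^ 3) * P1 (y / (1 - x))%R
                + RtoC (y / (1 - x) ^ 2) ^ 2 * P2 (y / (1 - x))%R))
    (fun x y => A1 x * (RtoC (/ (1 - x)) * P1 (y / (1 - x))%R)
       + A x * (RtoC (/ (1 - x) ^ 2) * P1 (y / (1 - x))%R
                + RtoC (/ (1 - x)) * RtoC (y / (1 - x) ^ 2) * P2 (y / (1 - x))%R))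
    (fun x y => A x * (RtoC (/ (1 - x)) ^ 2 * P2 (y / (1 - x))%R)).
Proof.
  intros HA HP x y H. pose proof (triangle_ratio x y H) as Hu.
  destruct H as (Hx & Hy & Hxy).
  destruct (HA x) as [HA1 HA2]; [lra|].
  destruct (HP _ Hu) as [HP1 HP2].
  assert (Ux : is_derive (fun t => (y / (1 - t))%R) x (y / (1 - x) ^ 2)%R)
    by (auto_derive; [lra | field; lra]).
  assert (Uy : is_derive (fun t => (t / (1 - x))%R) y (/ (1 - x))%R)
    by (auto_derive; [lra | field; lra]).
  assert (Uxx : is_derive (fun t => (y / (1 - t) ^ 2)%R) x (2 * y / (1 - x) ^ 3)%R).
  { auto_derive; [nra | field; lra]. }
  assert (Uxy : is_derive (fun t => (/ (1 - t))%R) x (/ (1 - x) ^ 2)%R).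
  { auto_derive; [lra | field; lra]. }
  apply is_CDerive_RtoC in Uxx, Uxy.
  pose proof (is_CDerive_comp P (fun t => y / (1 - t))%R _ _ _ HP1 Ux) as Px.
  pose proof (is_CDerive_comp P (fun t => t / (1 - x))%R _ _ _ HP1 Uy) as Py.
  pose proof (is_CDerive_comp P1 (fun t => y / (1 - t))%R _ _ _ HP2 Ux) as P1x.
  pose proof (is_CDerive_comp P1 (fun t => t / (1 - x))%R _ _ _ HP2 Uy) as P1y.
  cbn beta in *.
  refine (conj _ (conj _ (conj _ (conj _ _)))).
  all: eapply is_CDerive_eq; [cderive |].
  all: cbn beta; ring.
Qed.

(** * The factor in x and its differential equation *)

Definition log_slope (e : C) (k : nat) (x : R) : C := e / x - INR k / (1 - x).

Lemma RtoC_neq_0 r : r <> 0%R -> RtoC r <> 0.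
Proof. intros H E. now apply RtoC_inj in E. Qed.

Lemma is_CDerive_log_slope e k x : (0 < x < 1)%R ->
  is_CDerive (log_slope e k) x (- (e / x ^ 2) - INR k / (1 - x) ^ 2).
Proof.
  intros Hx.
  assert (H1 : is_derive (fun t => / t)%R x (- / x ^ 2)%R)
    by (auto_derive; [lra | field; lra]).
  assert (H2 : is_derive (fun t => - (INR k / (1 - t)))%R x (- (INR k / (1 - x) ^ 2))%R)
    by (auto_derive; [lra | field; lra]).
  apply is_CDerive_RtoC in H1, H2.
  assert (Hx0 : RtoC x <> 0) by (apply RtoC_neq_0; lra).
  assert (Hx1 : 1 - RtoC x <> 0)
    by (rewrite <- RtoC_minus; apply RtoC_neq_0; lra).
  (* Moving the inverses from C to R needs nonzero denominators, so the two forms are compared only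
     on (0,1). *)
  apply is_CDerive_ext_loc with
    (f := fun t => e * RtoC (/ t) + RtoC (- (INR k / (1 - t)))).
  - apply locally_open with (D := fun t => (0 < t < 1)%R); [| | exact Hx].
    + apply open_and; [apply open_gt | apply open_lt].
    + intros t Ht. unfold log_slope.
      rewrite RtoC_opp, RtoC_inv, RtoC_div, RtoC_minus by lra.
      unfold Cdiv, Cminus. reflexivity.
  - eapply is_CDerive_eq; [cderive |]. cbn beta.
    rewrite !RtoC_opp, !RtoC_inv, !RtoC_div by (try apply pow_nonzero; lra).
    rewrite !RtoC_pow, RtoC_minus. field. auto.
Qed.

(* Eliminating [F1] and [F2] through [h F = A] and [h F1 = s A - A'], with
   [h = x^e (1-x)^k] and [s = h'/h], turns the Gauss equation at [1 - x] into
   an equation for [A = h F]. *)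
Lemma weighted_hyp2F1_ode p q g e k :
  (forall n, g + INR n <> 0) ->
  let A x := Rpow_C x e * hyp2F1 p q g (1 - x) * (1 - x) ^ k in
  exists A1 A2 : R -> C, forall x, (0 < x < 1)%R ->
    is_CDerive A x (A1 x) /\ is_CDerive A1 x (A2 x) /\
    let s := log_slope e k x in
    A2 x = (- (e / x ^ 2) - INR k / (1 - x) ^ 2 - s ^ 2) * A x + 2 * s * A1 x
      + (p * q * A x - (g - (p + q + 1) * (1 - x)) * (s * A x - A1 x))
        / (x * (1 - x)).
Proof.
  intros Hg A.
  destruct (hyp2F1_ode p q g Hg) as (F1 & F2 & HF).
  set (h := fun x => Rpow_C x e * RtoC ((1 - x) ^ k)).
  set (F := fun x : R => hyp2F1 p q g (RtoC x)).
  (* With h' = s h, these are the first two derivatives of h(x) F(1-x); the inner function 1-x gives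
     each odd derivative of F a minus sign. *)
  exists (fun x => h x * (log_slope e k x * F (1 - x)%R - F1 (1 - x)%R)).
  exists (fun x => h x * ((log_slope e k x ^ 2 + (- (e / x ^ 2) - INR k / (1 - x) ^ 2))
    * F (1 - x)%R - 2 * log_slope e k x * F1 (1 - x)%R + F2 (1 - x)%R)).
  assert (EA : forall x, A x = h x * F (1 - x)%R).
  { intros x. unfold A, h, F. rewrite RtoC_pow, !RtoC_minus. ring. }
  intros x Hx.
  destruct (HF (1 - x)%R) as (HF1 & HF2 & ODE);
    [rewrite Rabs_pos_eq; lra |].
  assert (Dr : is_derive (fun t => 1 - t)%R x (-1)%R)
    by (auto_derive; [easy | ring]).
  pose proof (is_CDerive_comp F (fun t => 1 - t)%R _ _ _ HF1 Dr) as DF.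
  pose proof (is_CDerive_comp F1 (fun t => 1 - t)%R _ _ _ HF2 Dr) as DF1.
  cbn beta in DF, DF1.
  assert (Hx0 : RtoC x <> 0) by (apply RtoC_neq_0; lra).
  assert (Hx1 : 1 - RtoC x <> 0)
    by (rewrite <- RtoC_minus; apply RtoC_neq_0; lra).
  assert (Dh : is_CDerive h x (log_slope e k x * h x)).
  { assert (Dw : is_derive (fun t => (1 - t) ^ k)%R x
      (- (INR k / (1 - x)) * (1 - x) ^ k)%R).
    { auto_derive; [easy |].
      change (1 + - x)%R with (1 - x)%R.
      (* For k = 0 the predecessor in the exponent truncates to 0, so that case is checked apart. *)
      destruct k as [|j]; [cbn; field | cbn [Nat.pred pow]; field]; lra. }
    apply is_CDerive_RtoC in Dw.
    pose proof (is_CDerive_Rpow_C e x (proj1 Hx)) as Dp.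
    unfold h. eapply is_CDerive_eq; [cderive |].
    rewrite RtoC_mult, RtoC_opp, RtoC_div, RtoC_minus by lra.
    unfold log_slope. field. auto. }
  pose proof (is_CDerive_log_slope e k x Hx) as Ds.
  split; [|split].
  - apply is_CDerive_ext with (f := fun x => h x * F (1 - x)%R);
      [intros; symmetry; apply EA |].
    eapply is_CDerive_eq; [cderive |]. cbn beta. ring.
  - apply is_CDerive_ext with (f := fun x => h x *
      (log_slope e k x * F (1 - x)%R + (- (1)) * F1 (1 - x)%R));
      [intros; ring |].
    eapply is_CDerive_eq; [cderive |]. cbn beta. ring.
  - cbv zeta. rewrite !EA.
    change (hyp2F1 p q g (RtoC (1 - x))) with (F (1 - x)%R) in ODE.
    (* At t = 1-x the leading coefficient t(1-t) is x(1-x), nonzero here, so the Gauss equation can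
       be solved for [F2]. The remaining identity holds for any value of the slope. *)
    replace (F2 (1 - x)%R) with ((p * q * F (1 - x)%R
      - (g - (p + q + 1) * (1 - x)) * F1 (1 - x)%R) / (x * (1 - x))).
    { generalize (log_slope e k x). intros s. field. auto. }
    rewrite <- ODE, !RtoC_minus. field. auto.
Qed.

End Separation.

(** * Verification of the two eigenvalue equations *)

Theorem theorem4p1 :
  forall (a b c d : R) (k : nat) (m : C),
  (forall n : nat, (b + 1)%R <> (- INR n)%R) ->
  (forall n : nat, (2 * INR k + b + c + 2)%R <> (- INR n)%R) ->
  forall x y : R, in_triangle x y ->
  partials_exist (Psi a b c d m k) x y /\
  C23 b c (Psi a b c d m k) x y =
    (((2 * INR k + b + c + 1) ^ 2 - 1) / 4 * Psi a b c d m k x y)%C /\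
  C123 a b c d (Psi a b c d m k) x y =
    ((4 * m ^ 2 - 1) / 4 * Psi a b c d m k x y)%C.
Proof.
  intros a b c d k m Hb Hk x y Hxy.
  (* Genericity says exactly that the lower parameters b + 1 of [Phat] and 2k + b + c + 2 of [psi]
     are admissible. *)
  assert (Gb : forall n : nat, (RtoC b + 1 + INR n <> 0)%C).
  { intros n. rewrite <- !RtoC_plus. apply RtoC_neq_0.
    specialize (Hb n). lra. }
  assert (Gk : forall n : nat, (RtoC (2 * INR k + b + c + 1) + 1 + INR n <> 0)%C).
  { intros n. rewrite <- !RtoC_plus. apply RtoC_neq_0.
    specialize (Hk n). lra. }
  destruct (hyp2F1_ode (- INR k) (INR k + b + c + 1) (b + 1) Gb)
    as (P1 & P2 & HP).
  set (beta := (2 * INR k + b + c + 1)%R) in *.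
  set (gam := (d - b - c)%R). set (delta := (2 * a + d + 2)%R).
  destruct (weighted_hyp2F1_ode (m + (beta + gam + 1) / 2)
    (m + (beta - gam + 1) / 2) (beta + 1) (m - (delta + 1) / 2) k Gk)
    as (A1 & A2 & HA).
  set (A := fun x : R => (psi m beta gam delta x * (1 - x) ^ k)%C).
  assert (DA : forall t, (0 < t < 1)%R ->
    is_CDerive A t (A1 t) /\ is_CDerive A1 t (A2 t)).
  { intros t Ht. destruct (HA t Ht) as (H1 & H2 & _). now split. }
  assert (DP : forall u, (0 < u < 1)%R ->
    is_CDerive (Phat k b c) u (P1 u) /\ is_CDerive P1 u (P2 u)).
  { intros u Hu. destruct (HP u) as (H1 & H2 & _);
      [rewrite Rabs_pos_eq; lra | now split]. }
  (* [Psi] is convertible to the separated product, so the type annotation suffices. *)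
  pose proof (separated_jet A A1 A2 (Phat k b c) P1 P2 DA DP
    : has_jet (Psi a b c d m k) _ _ _ _ _) as J.
  split; [now apply (jet_partials_exist _ _ _ _ _ _ J) |].
  pose proof Hxy as (Hx & Hy & Hs).
  assert (EPsi : Psi a b c d m k x y = (A x * Phat k b c (y / (1 - x)))%C)
    by reflexivity.
  destruct (HA x) as (_ & _ & OA); [lra |]. cbv zeta in OA.
  change (Rpow_C x _ * _ * _)%C with (A x) in OA.
  set (u := (y / (1 - x))%R) in *.
  pose proof (triangle_ratio x y Hxy : (0 < u < 1)%R) as Hu.
  destruct (HP u) as (_ & _ & OP); [rewrite Rabs_pos_eq; lra |].
  change (hyp2F1 _ _ _ u) with (Phat k b c u) in OP.
  assert (Hx0 : RtoC x <> 0%C) by (apply RtoC_neq_0; lra).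
  assert (Hy0 : RtoC y <> 0%C) by (apply RtoC_neq_0; lra).
  assert (Hx1 : (1 - RtoC x)%C <> 0%C)
    by (rewrite <- RtoC_minus; apply RtoC_neq_0; lra).
  assert (Hxy1 : (1 - RtoC x - RtoC y)%C <> 0%C)
    by (rewrite <- !RtoC_minus; apply RtoC_neq_0; lra).
  assert (Eu : RtoC u = (y / (1 - x))%C)
    by (unfold u; rewrite RtoC_div, RtoC_minus by lra; reflexivity).
  (* The Gauss equation for the Jacobi factor solved for the second derivative, using u(1-u) =
     y(1-x-y)/(1-x)^2. *)
  assert (OP2 : P2 u = ((- INR k * (INR k + b + c + 1) * Phat k b c u
    - (b + 1 - (b + c + 2) * (y / (1 - x))) * P1 u)
    * (1 - x) ^ 2 / (y * (1 - x - y)))%C).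
  { replace (- INR k * (INR k + b + c + 1) * Phat k b c u)%C with
      (u * (1 - u) * P2 u +
       (b + 1 - (- INR k + (INR k + b + c + 1) + 1) * u) * P1 u)%C.
    rewrite Eu. field. auto. }
  assert (Hq2 : (1 - x) ^ 2 <> 0%R) by (apply pow_nonzero; lra).
  assert (Hq3 : (1 - x) ^ 3 <> 0%R) by (apply pow_nonzero; lra).
  assert (Hq1 : (1 - x <> 0)%R) by lra.
  split.
  (* Only y-derivatives occur, so [A x] is a common factor. The equation for P turns -L1 into
     k(k+b+c+1), which completes the square to the stated eigenvalue. *)
  - unfold C23. rewrite (jet_L1 _ _ _ _ _ _ J) by easy.
    rewrite EPsi. fold u. rewrite OP2.
    rewrite !RtoC_inv, !RtoC_minus by easy.
    field. auto.
  - unfold C123, comm, anticomm, C234.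
    rewrite (jet_L _ _ _ _ _ _ (jet_X1 _ _ _ _ _ _ J)) by easy.
    unfold X1. rewrite (jet_L _ _ _ _ _ _ J) by easy.
    (* Once both second derivatives are eliminated, only the values and first derivatives of the two
       factors remain, with rational coefficients in x and y. *)
    rewrite EPsi. fold u. rewrite OP2, OA.
    rewrite !RtoC_inv, !RtoC_div, !RtoC_pow, !RtoC_mult, !RtoC_minus by easy.
    (* The cancellation depends on how these parameters are built from a, b, c, d and k, so they
       must be visible to [field]. *)
    unfold beta, gam, delta, log_slope.
    repeat rewrite ?RtoC_plus, ?RtoC_minus, ?RtoC_mult.
    field. auto.
Qed.
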